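(* If $X$ and $Y$ are homeomorphic Hausdorff spaces, then $Ab(X)=Ab(Y)$.
   Context: All spaces are Hausdorff, and subsets carry the subspace topology. A continuum is a compact, connected, Hausdorff space. For a space $Y$ and points $x,z\in Y$, $\mathcal{C}(x,z,Y)$ denotes the collection of open connected subsets of $Y$ containing both $x$ and $z$. $cl_Y$ and $\partial_Y$ denote closure and boundary in $Y$. Line of sight: let $Y$ be a nonempty Hausdorff space, $x,z\in Y$ distinct points, and $K\subseteq Y\setminus\{z\}$ a subspace containing $x$. A continuum $C\subseteq Y$ containing $x$ and $z$ is a line of sight (in $Y$, with respect to $K$) from $z$ to $x$ if: (i) $\mathcal{C}(x,z,Y)$ contains a neighborhood basis for $C$, i.e. every open subset of $Y$ containing $C$ contains an element of $\mathcal{C}(x,z,Y)$ that contains $C$; and (ii) for every $U\subseteq K$ open in $K$ with $x\in U$ there is $V_U\in\mathcal{C}(x,z,Y)$ with $C\subseteq V_U$ and $V_U\cap K\subseteq cl_Y(V_U)\cap K\subseteq U$. Abbott dimension: let $X$ be a nonempty Hausdorff space. Let $X_0$ be the power set of $X$. Given $X_n$ ($n\geq 0$), let $X_{n+1}$ be the collection of all $Y\subseteq X$ for which there is a nonempty $K\in X_n$ such that (1) $K\subseteq Y$; and (2) there is a point $z\in Y\setminus K$ such that for every $x\in K$ there is a line of sight $W_{z,x}\subseteq Y$ (in $Y$, with respect to $K$) from $z$ to $x$ with the following property: there is $V\in\mathcal{C}(x,z,Y)$ containing $W_{z,x}$ such that whenever $V'\in\mathcal{C}(x,z,Y)$ satisfies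 $W_{z,x}\subseteq V'\subseteq V$, there is $D\subseteq\partial_Y(V')$ with $D\in X_n$. Then $Ab(X)$ is the greatest $n$ with $X_n\neq\emptyset$, and $Ab(X)=\infty$ if $X_n\neq\emptyset$ for all $n$. Also $Ab(\emptyset)=-1$. *)

(* Defs.v *)
From HB Require Import structures.
From mathcomp Require Import all_boot all_order all_algebra.
From mathcomp Require Import all_classical.
From mathcomp Require Import constructive_ereal topology.

Set Implicit Arguments.
Unset Strict Implicit.
Unset Printing Implicit Defensive.

Local Open Scope classical_set_scope.

(* A subset [Y : set X] viewed as a space in its own right is the type
   [set_type Y], which carries the initial (i.e. subspace) topology of the
   inclusion [set_val : set_type Y -> X]. *)

Definition homeomorphic (X Y : topologicalType) : Prop :=
  exists (f : X -> Y) (g : Y -> X),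
    [/\ cancel f g, cancel g f, continuous f & continuous g].

Section LineOfSight.
Context {Y : topologicalType}.
Implicit Types (x z : Y) (A C K U V W : set Y).

Definition boundary A : set Y := closure A `\` interior A.

Definition continuum C : Prop :=
  [/\ compact C, connected C & hausdorff_space (set_type C)].

Definition open_connected_nbhds x z : set (set Y) :=
  [set V | [/\ open V, connected V, V x & V z]].

Definition open_in K U : Prop := exists2 O, open O & U = O `&` K.

(* [x != z] is not listed, since it follows from [K x] and [~ K z]. *)
Definition line_of_sight K z x C : Prop :=
  [/\ K x /\ ~ K z,
      [/\ continuum C, C x & C z],
      (forall O, open O -> C `<=` O ->
         exists V, [/\ open_connected_nbhds x z V, C `<=` V & V `<=` O])
    & (forall U, U `<=` K -> open_in K U -> U x ->
         exists V, [/\ open_connected_nbhds x z V, C `<=` V,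
                       V `&` K `<=` closure V `&` K
                     & closure V `&` K `<=` U])].

End LineOfSight.

Section AbbottDimension.
Variable X : topologicalType.

Definition abbott_step (L : set (set X)) : set (set X) :=
  [set Y | exists K : set X,
    [/\ L K, K !=set0, K `<=` Y
      & exists z : set_type Y, ~ K (set_val z) /\
        forall x : set_type Y, K (set_val x) ->
          exists W : set (set_type Y),
            line_of_sight (set_val @^-1` K) z x W /\
            exists V : set (set_type Y),
              [/\ open_connected_nbhds x z V, W `<=` V
                & forall V' : set (set_type Y),
                    open_connected_nbhds x z V' -> W `<=` V' -> V' `<=` V ->
                    exists2 D : set X,
                      D `<=` set_val @` boundary V' & L D]]].

Fixpoint abbott_layer (n : nat) : set (set X) :=
  if n is m.+1 then abbott_step (abbott_layer m) else [set: set X].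

(* By the next two lemmas, the set of [n] with [abbott_layer n] nonempty is an
   initial segment of [nat] containing 0, so the default value of [xget] in
   [Ab] is never used. *)
Lemma abbott_layer0_neq0 : abbott_layer 0 !=set0.
Proof. by exists set0. Qed.

Lemma abbott_layer_neq0_leq (m n : nat) :
  (m <= n)%N -> abbott_layer n !=set0 -> abbott_layer m !=set0.
Proof.
elim: n => [|n IHn]; first by rewrite leqn0 => /eqP ->.
rewrite leq_eqVlt => /predU1P[->//|]; rewrite ltnS => /IHn IH [Y [K [LK _ _ _]]].
by apply: IH; exists K.
Qed.

Definition is_greatest_layer (n : nat) : Prop :=
  abbott_layer n !=set0 /\ forall m, abbott_layer m !=set0 -> (m <= n)%N.

Definition Ab : \bar int :=
  if pselect ([set: X] = set0) then (-1%:Z)%:E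
  else if pselect (forall n, abbott_layer n !=set0) then +oo%E
  else (xget 0%N is_greatest_layer)%:Z%:E.

End AbbottDimension.

(* Main.v *)
(* A homeomorphism f with inverse g transports a subset A to g^-1(A) = f(A),
   and restricts to a homeomorphism A -> g^-1(A).  Lines of sight and
   boundaries computed in A are therefore carried to those computed in g^-1(A),
   and by induction f carries the n-th layer of X into that of Y. *)
Require Import Defs.
From mathcomp Require Import all_boot all_order all_algebra.
From mathcomp Require Import all_classical.
From mathcomp Require Import constructive_ereal topology.

Set Implicit Arguments.
Unset Strict Implicit.
Unset Printing Implicit Defensive.

Local Open Scope classical_set_scope.

(** The inverse is carried as explicit data, so that every transport lemma also runs backwards by
    swapping [f] and [g]. *)
Definition inverse_homeos (S T : topologicalType) (f : S -> T) (g : T -> S) :=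
  [/\ cancel f g, cancel g f, continuous f & continuous g].

Lemma inverse_homeos_sym (S T : topologicalType) (f : S -> T) (g : T -> S) :
  inverse_homeos f g -> inverse_homeos g f.
Proof. by case. Qed.

Lemma hausdorff_inj_continuous (S T : topologicalType) (f : S -> T) :
  injective f -> continuous f -> hausdorff_space T -> hausdorff_space S.
Proof.
move=> finj fcont hT x y cxy; apply/finj/hT => A B fxA fyB.
have [s [As Bs]] := cxy _ _ (fcont x _ fxA) (fcont y _ fyB).
by exists (f s).
Qed.

Definition set_type_map (S T : Type) (f : S -> T) (A : set S) (B : set T)
  (AB : forall x, A x -> B (f x)) (x : A) : B :=
  exist _ (f (set_val x)) (mem_set (AB _ (set_mem (valP x)))).

(** By the universal property of the initial topology, it suffices to compose with the inclusion of
    [B], which gives [f] after the inclusion of [A]. *)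
Lemma continuous_set_type_map (S T : topologicalType) (f : S -> T)
  (A : set S) (B : set T) (AB : forall x, A x -> B (f x)) :
  continuous f -> continuous (set_type_map AB).
Proof.
move=> fcont; apply: continuous_comp_initial => x.
apply: (@continuous_comp _ _ _ (set_val : A -> S) f); last exact: fcont.
exact: initial_continuous.
Qed.

Section Transport.
Context {S T : topologicalType} {f : S -> T} {g : T -> S}.
Hypothesis fg : inverse_homeos f g.

Let fK : cancel f g. Proof. by case: fg. Qed.
Let gK : cancel g f. Proof. by case: fg. Qed.
Let fcont : continuous f. Proof. by case: fg. Qed.
Let gcont : continuous g. Proof. by case: fg. Qed.

(** Transport is written as a preimage because preimages commute with set operations; the image form
    serves for compactness and connectedness, which pass to continuous images. *)
Lemma homeo_preimageE (A : set S) : g @^-1` A = f @` A.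
Proof.
apply/seteqP; split=> [y Agy|_ [x Ax <-]] /=; last by rewrite fK.
by exists (g y).
Qed.

Lemma homeo_preimageK (A : set S) : f @^-1` (g @^-1` A) = A.
Proof. by apply/seteqP; split=> x /=; rewrite fK. Qed.

Lemma homeo_preimage_sub (A : set S) (B : set T) :
  A `<=` f @^-1` B -> g @^-1` A `<=` B.
Proof. by move=> AB y /AB /=; rewrite gK. Qed.

Lemma homeo_sub_preimage (A : set S) (B : set T) :
  f @^-1` B `<=` A -> B `<=` g @^-1` A.
Proof. by move=> BA y By; apply: BA; rewrite /= gK. Qed.

Lemma homeo_open (A : set S) : open A -> open (g @^-1` A).
Proof. by move: A; apply/continuousP. Qed.

Lemma homeo_connected (A : set S) : connected A -> connected (g @^-1` A).
Proof.
move=> cA; rewrite homeo_preimageE.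
by apply: connected_continuous_connected => //; exact: continuous_subspaceT.
Qed.

(** One inclusion pulls neighbourhoods back along [g], the other along [f]. *)
Lemma homeo_closure (A : set S) : closure (g @^-1` A) = g @^-1` closure A.
Proof.
apply/seteqP; split=> y cy B nB.
  have [z [Agz Bgz]] := cy _ (gcont nB).
  by exists (g z).
have nfB : nbhs (g y) (f @^-1` B) by apply: fcont; rewrite gK.
have [s [As Bs]] := cy _ nfB.
by exists (f s); split=> //=; rewrite fK.
Qed.

Lemma homeo_interior (A : set S) : (g @^-1` A)° = g @^-1` A°.
Proof.
by rewrite -[A]setCK -preimage_setC !interiorC homeo_closure preimage_setC.
Qed.

Lemma homeo_boundary (A : set S) : boundary (g @^-1` A) = g @^-1` boundary A.
Proof. by rewrite /boundary homeo_closure homeo_interior. Qed.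

Lemma homeo_continuum (C : set S) : continuum C -> continuum (g @^-1` C).
Proof.
case=> cC coC hC; split; last 1 first.
(* The Hausdorff condition concerns the subspace, so it is pulled back from [C] along the
   restriction of [g], which is injective. *)
- have gC : forall y, (g @^-1` C) y -> C (g y) by [].
  apply: (@hausdorff_inj_continuous _ _ (set_type_map gC)) hC.
    by move=> x y [] /(can_inj gK) /val_inj.
  exact: continuous_set_type_map.
- rewrite homeo_preimageE; apply: continuous_compact => //.
  exact: continuous_subspaceT.
- exact: homeo_connected.
Qed.

Lemma homeo_open_connected_nbhds (x z : S) (V : set S) :
  open_connected_nbhds x z V ->
  open_connected_nbhds (f x) (f z) (g @^-1` V).
Proof.
case=> oV cV Vx Vz; split; rewrite /= ?fK //; first exact: homeo_open.
exact: homeo_connected.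
Qed.

Lemma homeo_open_in (K U : set S) :
  open_in K U -> open_in (g @^-1` K) (g @^-1` U).
Proof. by case=> O oO ->; exists (g @^-1` O) => //; exact: homeo_open. Qed.

End Transport.

(** In both neighbourhood conditions the given set is pulled back along [f], the condition is
    applied in [S], and the resulting [V] is pushed forward. *)
Lemma homeo_line_of_sight (S T : topologicalType) (f : S -> T) (g : T -> S)
  (K C : set S) (z x : S) : inverse_homeos f g ->
  line_of_sight K z x C ->
  line_of_sight (g @^-1` K) (f z) (f x) (g @^-1` C).
Proof.
move=> fg; have [fK gK fcont gcont] := fg; have gf := inverse_homeos_sym fg.
case=> [[Kx nKz] [cC Cx Cz] basis sight]; split.
- by rewrite /= !fK.
- by split; rewrite /= ?fK //; exact: (homeo_continuum fg).
- move=> O oO CO.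
  have CfO : C `<=` f @^-1` O by move=> s Cs; apply: CO; rewrite /= fK.
  have [V [nV CV VO]] := basis _ (homeo_open gf oO) CfO.
  exists (g @^-1` V); split; first exact: (homeo_open_connected_nbhds fg).
  - exact: preimage_subset.
  - exact: (homeo_preimage_sub fg).
- move=> U UK oU Ux.
  have fUK : f @^-1` U `<=` K by move=> s /UK /=; rewrite fK.
  have ofU : open_in K (f @^-1` U).
    (* Seeing [K] as its own round trip lets relative openness pull back along [f]. *)
    by rewrite -(homeo_preimageK fg K); exact: (homeo_open_in gf).
  have [V [nV CV VK clVU]] := sight _ fUK ofU Ux.
  exists (g @^-1` V); split; first exact: (homeo_open_connected_nbhds fg).
  - exact: preimage_subset.
  - by rewrite (homeo_closure fg); exact: preimage_subset VK.
  - rewrite (homeo_closure fg) -preimage_setI.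
    exact: (homeo_preimage_sub fg).
Qed.

(** This is the inductive step. Lines of sight live in the subspace [A] and move by the restricted
    homeomorphism [F], while [K] and [D] are subsets of [X] and move by [f]. *)
Lemma homeo_abbott_step (X Y : topologicalType) (f : X -> Y) (g : Y -> X)
  (L : set (set X)) (M : set (set Y)) (A : set X) : inverse_homeos f g ->
  (forall D, L D -> M (g @^-1` D)) ->
  abbott_step L A -> abbott_step M (g @^-1` A).
Proof.
move=> fg LM [K [LK [k Kk] KA [z [nKz sight]]]].
have [fK gK fcont gcont] := fg.
have fA : forall x, A x -> (g @^-1` A) (f x) by move=> x; rewrite /= fK.
have gA : forall y, (g @^-1` A) y -> A (g y) by [].
pose F := set_type_map fA; pose G := set_type_map gA.
have FG : inverse_homeos F G.
  split; [move=> x | move=> y | exact: continuous_set_type_map..].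
  - by apply: val_inj; rewrite /= fK.
  - by apply: val_inj; rewrite /= gK.
have GF := inverse_homeos_sym FG.
have [FK GK _ _] := FG.
exists (g @^-1` K); split; [exact: LM | by exists (f k); rewrite /= fK | |].
  exact: preimage_subset.
exists (F z); split; first by rewrite /= fK.
move=> y Ky.
have [W [losW [V [nV WV bV]]]] := sight (G y) Ky.
exists (G @^-1` W); split.
  (* The trace of the transported [K] and the transport by [G] of the trace of [K] unfold to the
     same set. *)
  by have := homeo_line_of_sight FG losW; rewrite GK.
exists (G @^-1` V); split.
- by have := homeo_open_connected_nbhds FG nV; rewrite GK.
- exact: preimage_subset.
move=> V' nV' WV' V'V.
(* Pulled back to [A], the competitor [V'] lies between [W] and [V], so [bV] applies to it. *)
have nFV' := homeo_open_connected_nbhds GF nV'.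
rewrite FK in nFV'.
have WFV' : W `<=` F @^-1` V' by exact: (homeo_sub_preimage GF).
have FV'V : F @^-1` V' `<=` V by exact: (homeo_preimage_sub GF).
have [D Db LD] := bV _ nFV' WFV' FV'V.
exists (g @^-1` D); last exact: LM.
move=> y' /Db [a]; rewrite (homeo_boundary GF) => bFa ag.
by exists (F a) => //; rewrite -[RHS]gK -ag.
Qed.

Lemma homeo_abbott_layer (X Y : topologicalType) (f : X -> Y) (g : Y -> X)
  (n : nat) (A : set X) : inverse_homeos f g ->
  abbott_layer n A -> abbott_layer n (g @^-1` A).
Proof.
move=> fg; elim: n A => [//|n IHn] A.
exact: (homeo_abbott_step fg).
Qed.

(** An equality of propositions, rather than an equivalence, can be rewritten inside [pselect] and
    [xget]. *)
Lemma homeo_abbott_layer_neq0 (X Y : topologicalType) (n : nat) :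
  homeomorphic X Y ->
  (@abbott_layer X n !=set0) = (@abbott_layer Y n !=set0).
Proof.
case=> f [g fg]; apply/propext; split=> -[A LA].
  by exists (g @^-1` A); exact: (homeo_abbott_layer fg).
by exists (f @^-1` A); exact: (homeo_abbott_layer (inverse_homeos_sym fg)).
Qed.

Lemma homeo_setT_eq0 (X Y : topologicalType) :
  homeomorphic X Y -> ([set: X] = set0) = ([set: Y] = set0).
Proof.
case=> f [g _]; apply/propext; split=> /seteqP[e _]; apply/seteqP.
  by split=> // y _; case: (e (g y)).
by split=> // x _; case: (e (f x)).
Qed.

Theorem theorem3p9 (X Y : topologicalType)
  (hX : hausdorff_space X) (hY : hausdorff_space Y)
  (hXY : homeomorphic X Y) : Ab X = Ab Y.
Proof.
(* [Ab] sees the space only through its emptiness, the nonemptiness of all layers, and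
   [is_greatest_layer]; each of these is the same for [X] and [Y]. *)
have greatestE : @is_greatest_layer X = @is_greatest_layer Y.
  rewrite /is_greatest_layer; apply/funext => n.
  rewrite (homeo_abbott_layer_neq0 n hXY); congr (_ /\ _).
  by apply: eq_forall => m; rewrite (homeo_abbott_layer_neq0 m hXY).
have allE : (forall n, @abbott_layer X n !=set0) =
            (forall n, @abbott_layer Y n !=set0).
  by apply: eq_forall => n; exact: homeo_abbott_layer_neq0.
by rewrite /Ab (homeo_setT_eq0 hXY) allE greatestE.
Qed.
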